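(* Let $\Omega\subset\mathbb{R}^d$ be compact with a probability measure $\mu$, let $\mathbf{F}$ be a compact subset of $\mathcal{C}(\Omega)$, let $1\le q\le p<\infty$, and let $B\ge1$. There exist two positive constants $c$ and $C$, which may depend on $p$ and $q$, such that $$\varrho_m^{lp}(\mathbf{F},L_p)\le C\,d_n^{EqB}(\mathbf{F},L_\infty)$$ provided $m\ge cB^pn^{p/q}(\log(2Bn))^2$ ($m,n$ positive integers).
   Context: $\mathcal{C}(\Omega)$ is the space of continuous functions on $\Omega$ (also denoted $L_\infty$) with $\|f\|_\infty:=\max_{\mathbf{x}\in\Omega}|f(\mathbf{x})|$; $\|f\|_p:=\left(\int_\Omega|f|^p\,d\mu\right)^{1/p}$. Recovery algorithm: for points $\xi=\{\xi^j\}_{j=1}^m\subset\Omega$ (repetitions allowed) and a finite-dimensional space $X_N$ of functions, with equal weights $\mathbf{w}_m=(1/m,\dots,1/m)$, let $$\ell p\mathbf{w}_m(\xi,X_N)(f):=\operatorname*{arg\,min}_{u\in X_N}\left(\frac1m\sum_{\nu=1}^m|f(\xi^\nu)-u(\xi^\nu)|^p\right)^{1/p}$$ (a minimizer; any choice if it is not unique). Then $$\varrho_m^{lp}(\mathbf{F},L_p):=\inf_{\xi,\,X_N,\,N\le m}\ \sup_{f\in\mathbf{F}}\|f-\ell p\mathbf{w}_m(\xi,X_N)(f)\|_p,$$ where the infimum is over all $N$-dimensional subspaces $X_N\subset L_p(\Omega,\mu)$ with $N\le m$ and all collections $\xi$ of $m$ points in $\Omega$. Entropy numbers: for a Banach space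 $X$ and compact $A\subset X$, $\varepsilon_k(A,X):=\inf\{\varepsilon>0:\ \exists\,y^1,\dots,y^{2^k}\in A,\ A\subseteq\bigcup_{j=1}^{2^k}B_X(y^j,\varepsilon)\}$, where $B_X(y,r)=\{x\in X:\|x-y\|\le r\}$. Let $X_N^q:=\{f\in X_N:\|f\|_q\le1\}$. Condition EqB: an $N$-dimensional subspace $X_N$ (of continuous functions) satisfies Condition EqB, with $B\ge1$, if $\varepsilon_k(X_N^q,L_\infty)\le B(N/k)^{1/q}$ for $1\le k\le N$. The EqB-conditioned Kolmogorov width in the uniform norm is $$d_n^{EqB}(\mathbf{F},L_\infty):=\inf_{X_n}\ \sup_{f\in\mathbf{F}}\ \inf_{g\in X_n}\|f-g\|_\infty,$$ the infimum being over all $n$-dimensional subspaces $X_n$ satisfying Condition EqB (infimum over the empty set is $+\infty$). *)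

(* Defs.v *)
From HB Require Import structures.
From mathcomp Require Import all_boot all_order all_algebra.
From mathcomp Require Import all_classical all_reals all_analysis.

Set Implicit Arguments.
Unset Strict Implicit.
Unset Printing Implicit Defensive.

Import Order.TTheory GRing.Theory Num.Theory.
Import numFieldNormedType.Exports.

Local Open Scope classical_set_scope.
Local Open Scope ring_scope.

(* A subset [A] of a topological space, with its induced topology. Measurable
   types of MathComp-Analysis are pointed, hence the base point [a : A]; it
   plays no other role, and exists as soon as [A] carries a probability. *)
Definition pointed_subset (X : Type) (A : set X) (a : A) : Type := A.

HB.instance Definition _ (X : topologicalType) (A : set X) (a : A) :=
  Topological.copy (pointed_subset a) (A : Type).
HB.instance Definition _ (X : topologicalType) (A : set X) (a : A) :=
  isPointed.Build (pointed_subset a) a.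

Definition borel (T : ptopologicalType) := g_sigma_algebraType (@open T).

Section Definitions.
Context {R : realType} {T : ptopologicalType}.
Implicit Types (f g : T -> R) (X A F : set (T -> R)).

Definition uniform_norm f : \bar R := ereal_sup [set `|f x|%:E | x in setT].

Definition Lp_norm (mu : probability (borel T) R) (p : R) (f : borel T -> R) :
  \bar R := ('N[mu]_p%:E[EFin \o f])%E.

Definition lincomb N (u : 'I_N -> T -> R) (c : 'I_N -> R) : T -> R :=
  fun x => \sum_(i < N) c i * u i x.

Definition fun_span N (u : 'I_N -> T -> R) : set (T -> R) := range (lincomb u).

Definition subspace_C N X : Prop :=
  exists u : 'I_N -> T -> R,
    [/\ forall i, continuous (u i),
        forall c, (forall x, lincomb u c x = 0) -> forall i, c i = 0
      & X = fun_span u].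

(* [X] consists of functions defined everywhere, because recovery algorithms
   sample them at points. Its dimension is that of its image in
   L_p(T, mu): the basis is independent modulo almost everywhere equality. *)
Definition subspace_Lp (mu : probability (borel T) R) (p : R) N X : Prop :=
  exists u : 'I_N -> T -> R,
    [/\ forall i, (u i : borel T -> R) \in Lfun mu p%:E,
        forall c, {ae mu, forall x, lincomb u c x = 0} -> forall i, c i = 0
      & X = fun_span u].

Definition discrete_norm (p : R) m (xi : 'I_m -> T) f : R :=
  (m%:R^-1 * \sum_(j < m) `|f (xi j)| `^ p) `^ p^-1.

(* [rec xi X f] is a choice of minimizer, for all the data: points [xi], a
   finite-dimensional space of functions [X] and a function [f]. *)
Definition lp_recovery (p : R) m
    (rec : ('I_m -> T) -> set (T -> R) -> (T -> R) -> (T -> R)) : Prop :=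
  forall (xi : 'I_m -> T) N (u : 'I_N -> T -> R) f,
    fun_span u (rec xi (fun_span u) f) /\
    forall v, fun_span u v ->
      discrete_norm p xi (f \- rec xi (fun_span u) f)
        <= discrete_norm p xi (f \- v).

Definition rho_lp (mu : probability (borel T) R) (p : R) m
    (rec : ('I_m -> T) -> set (T -> R) -> (T -> R) -> (T -> R)) F : \bar R :=
  ereal_inf [set r | exists (xi : 'I_m -> T) N X,
    [/\ (0 < N <= m)%N, subspace_Lp mu p N X &
        r = ereal_sup [set Lp_norm mu p (f \- rec xi X f) | f in F]]].

(* The centers lie in [A]; the value is +oo if no finite radius works. *)
Definition entropy_number k A : \bar R :=
  ereal_inf [set e%:E | e in [set e : R | 0 < e /\
    exists y : 'I_(2 ^ k) -> T -> R, (forall j, A (y j)) /\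
      A `<=` \bigcup_j [set f : T -> R | (uniform_norm (f \- y j)%R <= e%:E)%E]]].

Definition Lq_ball (mu : probability (borel T) R) (q : R) X : set (T -> R) :=
  [set f | X f /\ (Lp_norm mu q f <= 1)%E].

Definition EqB (mu : probability (borel T) R) (q B : R) N X : Prop :=
  forall k, (1 <= k <= N)%N ->
    (entropy_number k (Lq_ball mu q X)
       <= (B * (N%:R / k%:R) `^ q^-1)%:E)%E.

Definition width_EqB (mu : probability (borel T) R) (q B : R) n F : \bar R :=
  ereal_inf [set r | exists X, [/\ subspace_C n X, EqB mu q B n X &
    r = ereal_sup [set ereal_inf [set uniform_norm (f \- g) | g in X]
                  | f in F]]].

End Definitions.

(* Main.v *)
Require Import Defs.
From HB Require Import structures.
From mathcomp Require Import all_boot all_order all_algebra.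
From mathcomp Require Import all_classical all_reals all_analysis.
From mathcomp Require Import perm measurable_realfun.
From mathcomp Require Import ring lra.

Set Implicit Arguments.
Unset Strict Implicit.
Unset Printing Implicit Defensive.

Import Order.TTheory GRing.Theory Num.Theory.
Import numFieldNormedType.Exports.

Local Open Scope classical_set_scope.
Local Open Scope ring_scope.

(** Least [p]-th power recovery from the points [xi] is as good as uniform
approximation from [X] as soon as the discrete norm dominates the [L_p] norm
on [X], with a bound [||h||_p <= 64 D(h)]. Indeed let [g] in [X] satisfy
[|f - g| <= c] and let [v] be the recovered function. Since [v] minimizes,
[D(f - v) <= D(f - g) <= c], hence [D(g - v) <= 4 c], hence
[||g - v||_p <= 256 c] and [||f - v||_p <= 257 c]
([recovery_error_le]).

The heart is therefore the one-sided discretization [EqB_discretization]. For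
[h] with [||h||_p = 1], slice [|h|] at the dyadic heights [a_j = 2^j / 2],
[j < L], where [2^L / 2] exceeds the uniform bound [K = 4 B n^(1/q)] that
Condition EqB imposes on the unit ball. The integral of [|h|^p] is comparable to
the sum of the [a_j^p mu {|h| >= a_j}], and the empirical moment to the same sum with
the empirical measure, so it suffices that every superlevel set receives its
share of the points. To have finitely many sets to care about, replace
[{|h| >= a_j}] by [{|y| >= 3 a_j / 4}] with [y] running over a net of radius
[a_j / 4] of the ball, of cardinality [N_j]. A potential-function argument
([exists_points_frequency]) yields [m] points whose frequency in each of
these sets is at least [mu / 2 - ln (L N_j) / m]. This is enough when
[L a_j^p ln (L N_j)] is at most a small multiple of [m] for every [j]
([discretization_of_nets]).

Higher slices weigh more but need coarser, hence smaller, nets. For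
[a_j > 8 B], Condition EqB with [k] close to [n (8 B / a_j)^q] gives
[ln N_j <= k], and [a_j^p k] is at most of the order of its value
[B^p n^(p/q)] at the top height [K] because [q <= p]. For [a_j <= 8 B] the
condition would be needed with [k > n]; there a net made by
interpolating at nearly Fekete points ([exists_interpolation_net]) serves, with
[ln N_j] of order [n ln (2 B n)]. This costs one factor [ln (2 B n)], and the
number [L] of slices the other. *)

(** * Powers and logarithms *)

Lemma le_powR_id (R : realType) (b r : R) : 1 <= b -> 1 <= r -> b <= b `^ r.
Proof.
move=> b1 r1; have b0 : 0 <= b by exact: le_trans ler01 b1.
by rewrite -[leLHS](powRr1 b0) ler_powR.
Qed.

Section LogBounds.
Context (R : realType).
Implicit Types x : R.

Lemma ln_le_id x : 0 < x -> ln x <= x.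
Proof.
move=> x0; have -> : x = 1 + (x - 1) by lra.
by apply: le_trans (@le_ln1Dx R (x - 1) _) _; lra.
Qed.

Lemma base1_powR x : 1 `^ x = 1.
Proof. by rewrite powR1. Qed.

Lemma ln2_ge_half : 2^-1 <= ln 2 :> R.
Proof.
have : ln (1 + (- 2^-1)) <= - 2^-1 :> R by apply: le_ln1Dx; lra.
have -> : 1 + - 2^-1 = 2^-1 :> R by lra.
rewrite lnV ?posrE//; lra.
Qed.

(** The factor 16 absorbs additive constants, using [ln x >= 1/2]. *)
Lemma exists_expr2_gt x : 2 <= x ->
  exists2 L : nat, 4 * x < 2 ^+ L & L%:R <= 16 * ln x.
Proof.
move=> x2.
have lnx : 2^-1 <= ln x.
  by apply: le_trans ln2_ge_half _; rewrite ler_ln ?posrE//; lra.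
exists (Num.truncn (2 * ln x + 6)).+1; last first.
  have r0 : 0 <= 2 * ln x + 6 by lra.
  have /andP[tr1 _] := truncn_itv r0.
  by rewrite -natr1; lra.
have := truncnS_gt (2 * ln x + 6); move: (Num.truncn _).+1 => L Lgt.
have -> : 2 ^+ L = expR (L%:R * ln 2) :> R by rewrite expRM_natl lnK ?posrE.
apply: (@le_lt_trans _ _ (expR (ln x + 3))).
  rewrite expRD lnK ?posrE; last lra.
  have : 1 + 3 <= expR 3 :> R by exact: expR_ge1Dx.
  by move=> e3; rewrite [4 * x]mulrC ler_pM2l; lra.
rewrite ltr_expR.
have : L%:R * 2^-1 <= L%:R * ln 2 :> R by rewrite ler_wpM2l// ln2_ge_half.
lra.
Qed.

(** Taking [L] minimal keeps all the heights [2 ^+ j / 2] at most [K], which bounds the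
weights of the slices; comparison with [exists_expr2_gt] makes [L] logarithmic. *)
Lemma exists_dyadic_levels (K x : R) : 2^-1 <= K -> 2 <= x -> 2 * K <= 4 * x ->
  exists L : nat, [/\ (0 < L)%N, K < 2 ^+ L / 2, L%:R <= 16 * ln x
    & forall j, (j < L)%N -> 2 ^+ j / 2 <= K].
Proof.
move=> K2 x2 Kx; have [L0 L0x L0ln] := exists_expr2_gt x2.
have ex : exists L, K < 2 ^+ L / 2 by exists L0; lra.
case: (ex_minnP ex) => L LP Lmin; exists L; split => //.
- rewrite lt0n; apply/eqP => L_0; move: LP; rewrite L_0 expr0 ltNge; apply/negP/negPn; lra.
- by apply: le_trans L0ln; rewrite ler_nat Lmin//; lra.
- by move=> j jL; rewrite leNgt; apply/negP => /Lmin; rewrite leqNgt jL.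
Qed.
End LogBounds.

(** * Choosing points without randomness *)

Section Sampling.
Context d (T : measurableType d) (R : realType) (mu : probability T R).

Lemma exists_le_average (g : T -> R) (c : R) :
  measurable_fun setT g -> (forall x, 0 <= g x) -> 0 <= c ->
  (\int[mu]_x (g x)%:E <= c%:E)%E -> exists x, g x <= c.
Proof.
move=> mg g0 c0 gc; apply: contrapT => /forallNP gltc.
have cg x : c < g x by rewrite ltNge; apply/negP/gltc.
pose e x : R := g x - c.
have mgc : measurable_fun setT (EFin \o e).
  by apply/measurable_EFinP; exact: measurable_funB.
have gc0 x : (0 <= (e x)%:E)%E by rewrite lee_fin /e subr_ge0 ltW.
have int_g : (\int[mu]_x (g x)%:E = \int[mu]_x (e x)%:E + c%:E)%E.
  rewrite -[X in (_ + X)%E]mule1 -(@probability_setT _ _ _ mu) -integral_cst//.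
  rewrite -ge0_integralD//.
  by apply: eq_integral => x _; rewrite -EFinD /e subrK.
have int0 : (\int[mu]_x (e x)%:E = 0)%E.
  apply/eqP; rewrite eq_le integral_ge0//= andbT.
  by move: gc; rewrite int_g -[X in (_ <= X)%E]add0e leeD2rE.
have: ae_eq mu setT (fun x => (e x)%:E) (cst 0%E).
  apply/(ae_eq_integral_abs mu measurableT mgc).
  by rewrite -int0; apply: eq_integral => x _; rewrite gee0_abs//; exact: gc0.
case=> N [mN muN0 sub].
suff NT : N = setT.
  have /eqP : (1 = 0 :> \bar R)%E by rewrite -(@probability_setT _ _ _ mu) -NT.
  by rewrite onee_eq0.
apply/seteqP; split=> // x _; apply: sub => /=.
move=> hex; have /eqP := hex I; rewrite eqe /e subr_eq0 => /eqP gxc.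
by have := cg x; rewrite gxc ltxx.
Qed.

(** The method of conditional expectations: averaged over one more point, the
weighted sum does not increase, so some choice of that point does not increase
it. The points are chosen one after the other, which avoids product measures. *)
Lemma exists_points_prod_le (I : finType) (h : I -> T -> R) (w : I -> R) (m : nat) :
  (forall i, measurable_fun setT (h i)) -> (forall i x, 0 <= h i x) ->
  (forall i, (\int[mu]_x (h i x)%:E <= 1)%E) -> (forall i, 0 <= w i) ->
  exists xi : 'I_m -> T, \sum_i w i * \prod_(j < m) h i (xi j) <= \sum_i w i.
Proof.
move=> mh h0 h1; elim: m w => [|m IH] w w0.
  exists (fun=> point); rewrite le_eqVlt; apply/orP; left; apply/eqP.
  by apply: eq_bigr => i _; rewrite big_ord0 mulr1.
have [x hx] : exists x, \sum_i w i * h i x <= \sum_i w i.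
  apply: exists_le_average.
  - by apply: measurable_sum => i; exact: measurable_funM.
  - by move=> x; apply: sumr_ge0 => i _; exact: mulr_ge0.
  - exact: sumr_ge0.
  - under eq_integral do rewrite -sumEFin.
    rewrite ge0_integral_sum//; last 2 first.
    + by move=> i; apply/measurable_EFinP; exact: measurable_funM.
    + by move=> i x _; rewrite lee_fin mulr_ge0.
    rewrite -sumEFin; apply: lee_sum => i _.
    under eq_integral do rewrite EFinM.
    rewrite ge0_integralZl_EFin//; last 2 first.
    + by move=> x _; rewrite lee_fin.
    + exact/measurable_EFinP.
    by rewrite -[leRHS]mule1; apply: lee_wpmul2l => //; rewrite lee_fin.
have [i|xi hxi] := IH (fun i => w i * h i x); first exact: mulr_ge0.
exists (fun j => oapp xi x (unlift ord0 j)).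
apply: le_trans hx; apply: le_trans hxi; rewrite le_eqVlt; apply/orP; left.
apply/eqP/eq_bigr => i _; rewrite big_ord_recl unlift_none/= mulrA; congr (_ * _).
by apply: eq_bigr => j _; rewrite liftK.
Qed.

(** A one-sided Chernoff bound for finitely many sets at once. The potential of
[U i] charges a factor [1/2] to each point falling in [U i], normalised by
[expR (mu (U i) / 2)] so that its mean is at most 1; a set visited too rarely
would make its product large. The weights [w] distribute the admissible
failure among the sets. *)
Lemma exists_points_frequency (I : finType) (U : I -> set T) (w : I -> R) (m : nat) :
  (forall i, measurable (U i)) -> (forall i, 0 < w i) ->
  exists xi : 'I_m -> T, forall i,
    m%:R * fine (mu (U i)) / 2 - ln ((\sum_k w k) / w i)
      <= \sum_(j < m) \1_(U i) (xi j).
Proof.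
move=> mU w0; pose u i := fine (mu (U i)).
have muE i : mu (U i) = (u i)%:E by rewrite fineK// fin_num_measure.
pose h i x := expR (u i / 2) * (1 - 2^-1 * \1_(U i) x) : R.
(* rewritten as a nonnegative combination, to integrate termwise *)
have hE i x : h i x = expR (u i / 2) / 2 * (1 + \1_(~` U i) x).
  rewrite /h !indicE in_setC; case: (x \in U i) => /=; lra.
have [||||xi] := @exists_points_prod_le I h w m.
- move=> i; apply: measurable_funM => //; apply: measurable_funB => //.
  by apply: measurable_funM => //; exact: measurable_indic.
- move=> i x; rewrite hE mulr_ge0 ?divr_ge0 ?expR_ge0// addr_ge0//.
- move=> i; under eq_integral do rewrite hE EFinM.
  rewrite ge0_integralZl_EFin//; last first.
    apply/measurable_EFinP; apply: measurable_funD => //.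
    by apply: measurable_indic; exact: measurableC.
  under eq_integral do rewrite EFinD.
  rewrite ge0_integralD//; last first.
    by apply/measurable_EFinP/measurable_indic; exact: measurableC.
  rewrite integral_cst//= [X in (1 * X)%E](@probability_setT _ _ _ mu) mule1.
  rewrite integral_indic//; last exact: measurableC.
  rewrite setIT [X in (1 + X)%E](probability_setC mu (mU i)) muE -EFinB -EFinD -EFinM lee_fin.
  rewrite -(@ler_pM2l _ (expR (- (u i / 2)))) ?expR_gt0// mulr1.
  have -> : expR (- (u i / 2)) * (expR (u i / 2) / 2 * (1 + (1 - u i))) =
    expR (- (u i / 2)) * expR (u i / 2) * (1 - u i / 2) by lra.
  rewrite -expRD addNr expR0 mul1r.
  exact: expR_ge1Dx.
- by move=> i; exact: ltW.
move=> hxi; exists xi => i; rewrite -/(u i).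
set W := \sum_k w k; set s := \sum_(j < m) _.
have W0 : 0 < W.
  by rewrite /W (bigD1 i)//= ltr_wpDr// sumr_ge0// => k _; exact: ltW.
have s0 : 0 <= s by exact: sumr_ge0.
have h2 x : 1 - 2^-1 * \1_(U i) x = expR (- ln 2 * \1_(U i) x) :> R.
  rewrite indicE; case: (x \in U i); rewrite /= ?(mulr0, mulr1).
    by rewrite expRN lnK ?posrE//; lra.
  by rewrite subr0 expR0.
have prodE : \prod_(j < m) h i (xi j) = expR (m%:R * (u i / 2) - ln 2 * s).
  rewrite /s big_distrr/= -sumrN expRD expR_sum.
  under eq_bigr do rewrite /h h2.
  rewrite big_split/= prodr_const card_ord -expRM_natl; congr (_ * _).
  by apply: eq_bigr => j _; rewrite mulNr.
have le1 : w i * expR (m%:R * (u i / 2) - ln 2 * s) <= W.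
  apply: le_trans hxi; rewrite (bigD1 i)//= prodE lerDl.
  apply: sumr_ge0 => k _; apply: mulr_ge0; first exact: ltW.
  apply: prodr_ge0 => j _; rewrite hE mulr_ge0 ?divr_ge0 ?expR_ge0// addr_ge0//.
have le2 : m%:R * (u i / 2) - ln 2 * s <= ln (W / w i).
  rewrite -ler_expR lnK ?posrE ?divr_gt0//.
  by rewrite ler_pdivlMr// mulrC.
have ln2 : ln 2 <= 1 :> R.
  by rewrite -[2]/(1 + 1); apply: le_ln1Dx; lra.
have : ln 2 * s <= s by rewrite ler_piMl.
by move: le2; rewrite mulrA; lra.
Qed.
End Sampling.

(** * From nets to a discretization of the moment *)

Lemma measurable_normr_powR d (T : measurableType d) (R : realType) (f : T -> R) (p : R) :
  measurable_fun setT f -> measurable_fun setT (fun x => `|f x| `^ p).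
Proof.
move=> mf; apply: (measurableT_comp (measurable_powR _)).
exact: measurableT_comp.
Qed.

Section Layers.
Context (R : realType).
Implicit Types (p t : R) (L j : nat).

Lemma powR_le_sum_layers p t L : 0 <= p -> 0 <= t -> t < 2 ^+ L / 2 ->
  t `^ p <= 2^-1 `^ p + \sum_(j < L) (2 ^+ j) `^ p * (2 ^+ j / 2 <= t)%R%:R.
Proof.
move=> p0 t0; elim: L => [|L IH] tL.
  rewrite big_ord0 addr0; apply: ge0_ler_powR; rewrite ?nnegrE//.
  by move: tL; rewrite expr0 div1r => /ltW.
rewrite big_ord_recr/= addrA; have [tL'|Lt] := ltP t (2 ^+ L / 2).
  by rewrite mulr0 addr0 IH.
rewrite mulr1 ler_wpDl//.
  by rewrite addr_ge0 ?powR_ge0// sumr_ge0// => j _; rewrite mulr_ge0 ?powR_ge0.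
apply: ge0_ler_powR; rewrite ?nnegrE ?exprn_ge0//.
by move: tL; rewrite exprS mulrAC divff// mul1r => /ltW.
Qed.

(** The sum is dominated by its last nonzero term because [(2 ^+ j / 2) `^ p] at least
doubles from one [j] to the next. *)
Lemma sum_layers_le_powR p t L : 1 <= p -> 0 <= t ->
  \sum_(j < L) (2 ^+ j / 2) `^ p * (2 ^+ j / 2 <= t)%R%:R <= 2 * t `^ p.
Proof.
move=> p1 t0.
have p0 : 0 <= p by lra.
have geom k : \sum_(j < k) (2 ^+ j / 2) `^ p <= (2 ^+ k / 2) `^ p :> R.
  elim: k => [|k IH]; first by rewrite big_ord0 powR_ge0.
  rewrite big_ord_recr/= exprS -mulrA.
  apply: (@le_trans _ _ (2 * (2 ^+ k / 2) `^ p)); first lra.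
  rewrite (@powRM _ 2)// ?divr_ge0 ?exprn_ge0//.
  rewrite ler_wpM2r ?powR_ge0//.
  by rewrite -[leLHS](@powRr1 R)// ler_powR//; lra.
elim: L => [|L IH]; first by rewrite big_ord0 mulr_ge0 ?powR_ge0.
rewrite big_ord_recr/=; have [Lt|_] := leP (2 ^+ L / 2) t; last by rewrite mulr0 addr0.
have -> : 2 * t `^ p = t `^ p + t `^ p by lra.
have Ltp : (2 ^+ L / 2) `^ p <= t `^ p.
  by apply: ge0_ler_powR; rewrite ?nnegrE ?divr_ge0 ?exprn_ge0.
rewrite mulr1 lerD// (le_trans _ Ltp)// (le_trans _ (geom L))//.
apply: ler_sum => j _; rewrite -[leRHS]mulr1 ler_wpM2l ?powR_ge0//.
by rewrite lern1 leq_b1.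
Qed.
End Layers.

Section Discretization.
Context d (T : measurableType d) (R : realType) (mu : probability T R).

(** Sets of the net at height [2 ^+ j / 2] get weight [1 / N j], so that the
weights sum to [L] and the loss in [exists_points_frequency] is
[ln (L * N j)]. The last hypothesis makes the losses of all the heights
together at most half of the mass [m / (4 * 2 `^ p)] found by integrating the layers. *)
Lemma discretization_of_nets (p : R) (m L : nat) (A : set (T -> R))
    (N : 'I_L -> nat) (y : forall j : 'I_L, 'I_(N j) -> T -> R) :
  1 <= p -> (forall j, (0 < N j)%N) ->
  (forall j i, measurable_fun setT (y j i)) ->
  (forall f, A f -> measurable_fun setT f /\ forall x, `|f x| < 2 ^+ L / 2) ->
  (forall f (j : 'I_L), A f -> exists i, forall x, `|f x - y j i x| <= 2 ^+ j / 8) ->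
  (forall j : 'I_L, L%:R * ((2 ^+ j / 2) `^ p * ln (L%:R * (N j)%:R))
     <= m%:R * (2 `^ p)^-1 / 8) ->
  exists xi : 'I_m -> T, forall f, A f ->
    (\int[mu]_x (`|f x| `^ p)%:E = 1)%E ->
    (2 `^ p)^-1 ^+ 2 / 16 * m%:R <= \sum_(s < m) `|f (xi s)| `^ p.
Proof.
move=> p1 N0 my Af net small.
have p0 : 0 <= p by lra.
pose I := {j : 'I_L & 'I_(N j)}.
pose U (u : I) := [set x | 2 ^+ (tag u) / 2 * (3 / 4) <= `|y (tag u) (tagged u) x|].
pose w (u : I) : R := (N (tag u))%:R^-1.
have sum_w : \sum_u w u = L%:R.
  rewrite -(@sig_big_dep _ _ _ _ _ predT (fun _ => predT) (fun j _ => (N j)%:R^-1))/=.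
  rewrite (eq_bigr (fun=> 1)) ?sumr_const ?card_ord// => j _.
  rewrite sumr_const (_ : #|_| = N j); last by rewrite -[RHS]card_ord; exact: eq_card.
  by rewrite -[LHS]mulr_natl divff// pnatr_eq0 -lt0n.
have mU u : measurable (U u).
  rewrite -[X in measurable X]setTI.
  apply: measurable_fun_le => //.
  exact: measurableT_comp.
have [|xi hxi] := @exists_points_frequency _ _ _ mu I U w m mU.
  by move=> u; rewrite invr_gt0 ltr0n.
exists xi => f /[dup] ff /Af [mf fL] intf.
pose i j := sval (cid (net f j ff)).
have fy j x : `|f x - y j (i j) x| <= 2 ^+ j / 8 by exact: (svalP (cid (net f j ff))).
pose V j := U (Tagged (fun j => 'I_(N j)) (i j)).
pose v j := fine (mu (V j)).
have mV j : measurable (V j) by exact: mU.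
have muE j : mu (V j) = (v j)%:E.
  by rewrite /v fineK// fin_num_measure//; exact: mU.
pose a (j : 'I_L) : R := 2 ^+ j / 2.
have a0 j : 0 < a j by rewrite divr_gt0// exprn_gt0.
have VE j x : \1_(V j) x = (a j * (3 / 4) <= `|y j (i j) x|)%R%:R :> R.
  by rewrite indicE /V /U mem_setE.
(* the thickened sets of the net lie between the superlevel sets of [f] at heights [a j] and [a j / 2] *)
have lowV j x : (a j <= `|f x|)%R%:R <= \1_(V j) x :> R.
  rewrite VE ler_nat; case: leP => //= afx.
  have -> // : a j * (3 / 4) <= `|y j (i j) x|.
  have := fy j x; have := ler_distD 0 (f x) (y j (i j) x).
  rewrite sub0r subr0 normrN.
  have := lerB_dist (f x) (y j (i j) x).
  by move: afx; rewrite /a; lra.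
have upV j x : \1_(V j) x <= (a j <= 2 * `|f x|)%R%:R :> R.
  rewrite VE ler_nat; case: leP => //= afx.
  have -> // : a j <= 2 * `|f x|.
  have := fy j x; rewrite distrC.
  have := lerB_dist (y j (i j) x) (f x).
  by move: afx; rewrite /a; lra.
have powa (j : 'I_L) : (2 ^+ j) `^ p = 2 `^ p * a j `^ p.
  rewrite -powRM//; last exact: ltW.
  by rewrite mulrC divfK.
have twop0 : 0 < 2 `^ p :> R by exact: powR_gt0.
have half : 2^-1 `^ p <= 2^-1 :> R.
  rewrite -[leRHS](@powRr1 R)//.
  by rewrite -[2^-1](@powR_inv1 R)// -!powRrM ler_powR//; lra.
have upper : 2^-1 <= 2 `^ p * \sum_j a j `^ p * v j.
  have : (1 <= (2^-1 `^ p + 2 `^ p * \sum_j a j `^ p * v j)%:E)%E.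
    rewrite -intf.
    apply: (@le_trans _ _ (\int[mu]_x (2^-1 `^ p + \sum_j 2 `^ p * a j `^ p * \1_(V j) x)%:E)%E).
      apply: ge0_le_integral => //.
      - by apply/measurable_EFinP; exact: measurable_normr_powR.
      - apply/measurable_EFinP; apply: measurable_funD => //.
        by apply: measurable_sum => j; apply: measurable_funM => //; exact: measurable_indic.
      - move=> x _; rewrite lee_fin.
        apply: le_trans (powR_le_sum_layers p0 _ (fL x)) _ => //.
        rewrite lerD2l; apply: ler_sum => j _.
        by rewrite powa ler_wpM2l ?mulr_ge0 ?powR_ge0// lowV.
    under eq_integral do rewrite EFinD.
    rewrite ge0_integralD//; last 2 first.
    - by move=> x _; rewrite lee_fin sumr_ge0// => j _; rewrite !mulr_ge0 ?powR_ge0.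
    - apply/measurable_EFinP.
      by apply: measurable_sum => j; apply: measurable_funM => //; exact: measurable_indic.
    rewrite integral_cst//= [X in (_ * X)%E](@probability_setT _ _ _ mu) mule1.
    rewrite EFinD leeD2l//.
    under eq_integral do rewrite -sumEFin.
    rewrite ge0_integral_sum//; last 2 first.
    - by move=> j; apply/measurable_EFinP; apply: measurable_funM => //; exact: measurable_indic.
    - by move=> j x _; rewrite lee_fin !mulr_ge0 ?powR_ge0.
    rewrite big_distrr/= -sumEFin; apply: lee_sum => j _.
    under eq_integral do rewrite EFinM.
    rewrite ge0_integralZl_EFin//; last 2 first.
    - by apply/measurable_EFinP; exact: measurable_indic.
    - by rewrite mulr_ge0 ?powR_ge0.
    rewrite integral_indic// setIT [X in (_ * X)%E]muE -EFinM lee_fin.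
    by rewrite mulrA.
  by rewrite lee_fin; lra.
have lower : \sum_j a j `^ p * \sum_(s < m) \1_(V j) (xi s)
    <= 2 * 2 `^ p * \sum_(s < m) `|f (xi s)| `^ p.
  under eq_bigr do rewrite big_distrr/=.
  rewrite exchange_big/= big_distrr/=; apply: ler_sum => s _.
  rewrite -mulrA -powRM//; apply: le_trans (sum_layers_le_powR L p1 _); last first.
    by rewrite mulr_ge0.
  by apply: ler_sum => j _; rewrite ler_wpM2l ?powR_ge0//; exact: upV.
have freq j : m%:R * v j / 2 - ln (L%:R * (N j)%:R) <= \sum_(s < m) \1_(V j) (xi s).
  have := hxi (Tagged (fun j => 'I_(N j)) (i j)).
  by rewrite sum_w /w/= invrK.
have mid : \sum_j a j `^ p * (m%:R * v j / 2 - ln (L%:R * (N j)%:R))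
    <= \sum_j a j `^ p * \sum_(s < m) \1_(V j) (xi s).
  by apply: ler_sum => j _; rewrite ler_wpM2l ?powR_ge0.
have err : \sum_j a j `^ p * ln (L%:R * (N j)%:R) <= m%:R * (2 `^ p)^-1 / 8.
  have [L0|L0] := eqVneq L 0%N.
    rewrite big1; first by rewrite !mulr_ge0// invr_ge0 ltW.
    by move=> j; have := ltn_ord j; rewrite {2}L0.
  have L0' : 0 < L%:R :> R by rewrite ltr0n lt0n.
  apply: (@le_trans _ _ (\sum_(j < L) L%:R^-1 * (m%:R * (2 `^ p)^-1 / 8))).
    by apply: ler_sum => j _; rewrite ler_pdivlMl//; exact: small.
  by rewrite sumr_const card_ord -[leLHS]mulr_natl mulrA divff ?gt_eqF// mul1r.
have midE : \sum_j a j `^ p * (m%:R * v j / 2 - ln (L%:R * (N j)%:R)) =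
    m%:R / 2 * (\sum_j a j `^ p * v j) - \sum_j a j `^ p * ln (L%:R * (N j)%:R).
  rewrite big_distrr/= -sumrB; apply: eq_bigr => j _; ring.
set S := \sum_(s < m) _ in lower *.
set Q := \sum_j a j `^ p * v j in upper midE.
set z := 2 `^ p in lower upper err twop0 *.
have Q1 : z^-1 / 2 <= Q by rewrite ler_pdivrMl.
have m0' : 0 <= m%:R :> R by [].
have h1 : m%:R * z^-1 / 8 <= 2 * z * S.
  have : m%:R / 2 * (z^-1 / 2) <= m%:R / 2 * Q by rewrite ler_wpM2l// divr_ge0.
  move: mid lower err; rewrite midE.
  lra.
rewrite expr2; have : z^-1 * (m%:R * z^-1 / 8) <= z^-1 * (2 * z * S).
  by rewrite ler_wpM2l// invr_ge0 ltW.
have -> : z^-1 * (2 * z * S) = 2 * S * (z^-1 * z) by ring.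
by rewrite mulVf ?gt_eqF//; lra.
Qed.
End Discretization.

(** * Interpolation nets *)

Section Interpolation.
Context (R : realType) (T : ptopologicalType).

Definition evaluation_mx n (u : 'I_n -> T -> R) k (x : 'I_k -> T) : 'M[R]_(k, n) :=
  \matrix_(i, j) u j (x i).

Lemma lincomb_evaluation n (u : 'I_n -> T -> R) k (x : 'I_k -> T) (c : 'cV_n) i :
  lincomb u (c ^~ 0) (x i) = (evaluation_mx u x *m c) i 0.
Proof. by rewrite mxE; apply: eq_bigr => j _; rewrite mxE mulrC. Qed.

(** Linear independence of functions is detected by finitely many points: as long
as the evaluations at [k < n] points have a common kernel vector [c], the
function with coefficients [c] is nonzero at some further point, which raises
the rank. *)
Lemma exists_row_free_evaluation n (u : 'I_n -> T -> R) k :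
  (forall c, (forall x, lincomb u c x = 0) -> forall i, c i = 0) ->
  (k <= n)%N -> exists x : 'I_k -> T, row_free (evaluation_mx u x).
Proof.
move=> ind; elim: k => [|k IH] kn.
  by exists (fun=> point); apply: inj_row_free => v _; apply/matrixP => i [].
have [x xfree] := IH (ltnW kn); pose A := evaluation_mx u x.
have coker0 : cokermx A != 0.
  by rewrite -mxrank_eq0 mxrank_coker (eqP xfree) subn_eq0 -ltnNge.
have [i0 [j0 c0]] : exists i j, cokermx A i j != 0.
  apply: contrapT => h; move/eqP: coker0; apply; apply/matrixP => i j.
  rewrite [RHS]mxE; apply: contrapT => /eqP ij; apply: h; by exists i, j.
pose c := col j0 (cokermx A).
have Ac : A *m c = 0 by rewrite /c colE mulmxA mulmx_coker mul0mx.
have [t ct] : exists t, lincomb u (c ^~ 0) t != 0.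
  apply: contrapT => h; move/eqP: c0; apply.
  have := ind (c ^~ 0) _ i0; rewrite mxE; apply=> t.
  by apply: contrapT => /eqP ht; apply: h; exists t.
exists (fun i => oapp x t (unlift ord0 i)).
apply: inj_row_free => v vM.
have sumE (e : 'cV_n) : \sum_i v 0 i * lincomb u (e ^~ 0) (oapp x t (unlift ord0 i)) = 0.
  transitivity ((v *m evaluation_mx u (fun i => oapp x t (unlift ord0 i)) *m e) 0 0).
    rewrite -mulmxA mxE; apply: eq_bigr => i _; congr (_ * _).
    exact: (lincomb_evaluation u (fun i => oapp x t (unlift ord0 i))).
  by rewrite vM mul0mx mxE.
have v0 : v 0 ord0 = 0.
  have := sumE c; rewrite big_ord_recl unlift_none/= big1 ?addr0.
    by move/eqP; rewrite mulf_eq0 (negbTE ct) orbF => /eqP.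
  by move=> i _; rewrite liftK/= lincomb_evaluation -/A Ac mxE mulr0.
pose v' : 'rV_k := \row_i v 0 (lift ord0 i).
have v'0 : v' = 0.
  apply: (row_free_inj xfree); rewrite mul0mx; apply/matrixP => i j; rewrite ord1 [RHS]mxE.
  have /matrixP/(_ 0 j) := vM; rewrite !mxE big_ord_recl v0 mul0r add0r => vl.
  by apply: etrans vl; apply: eq_bigr => l _; rewrite !mxE liftK.
apply/matrixP => i j; rewrite ord1 [RHS]mxE.
have [l ->|->//] := unliftP ord0 j.
by have /matrixP/(_ 0 l) := v'0; rewrite !mxE.
Qed.

Lemma normr_det_le n (A : 'M[R]_n) M : (forall i j, `|A i j| <= M) ->
  `|\det A| <= n`!%:R * M ^+ n.
Proof.
move=> AM; apply: le_trans (ler_norm_sum _ _ _) _.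
have -> : n`!%:R * M ^+ n = \sum_(s : 'S_n) M ^+ n.
  rewrite sumr_const mulr_natl; congr (_ *+ _).
  by rewrite -[LHS]card_Sn; exact: eq_card.
apply: ler_sum => s _.
rewrite normrM normrX normrN1 expr1n mul1r normr_prod.
rewrite -[n in M ^+ n]card_ord -prodr_const; apply: ler_prod => i _.
by rewrite normr_ge0 AM.
Qed.

(** Fekete points: at points that maximize the determinant of the evaluations up
to a factor 2, the Lagrange functions are quotients of two such determinants
by Cramer's rule, hence bounded by 2. The factor 2 dispenses with attaining
the supremum. *)
Lemma exists_near_lagrange_basis n (u : 'I_n -> T -> R) (M : R) :
  (forall i x, `|u i x| <= M) ->
  (forall c, (forall x, lincomb u c x = 0) -> forall i, c i = 0) ->
  exists (x : 'I_n -> T) (l : 'I_n -> 'I_n -> R),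
    (forall f, fun_span u f -> forall t, f t = \sum_i f (x i) * lincomb u (l i) t) /\
    (forall i t, `|lincomb u (l i) t| <= 2).
Proof.
move=> uM ind; pose D (x : 'I_n -> T) := \det (evaluation_mx u x).
have [x0 /[!row_free_unit] x0u] := exists_row_free_evaluation ind (leqnn n).
have D0 : 0 < `|D x0| by rewrite normr_gt0 -unitfE -unitmxE.
pose S := [set `|D x| | x in setT].
have supS : has_sup S.
  split; first by exists `|D x0|, x0.
  exists (n`!%:R * M ^+ n) => _ [x _ <-].
  by apply: normr_det_le => i j; rewrite mxE.
have leS x : `|D x| <= sup S by apply: ub_le_sup => //; [case: supS|exists x].
have supS0 : 0 < sup S by exact: lt_le_trans D0 (leS x0).
have [_ [x _ <-] xS] := sup_adherent (divr_gt0 supS0 (ltr0n R 2)) supS.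
have Dx : sup S <= 2 * `|D x| by lra.
have Dx0 : D x != 0 by rewrite -normr_gt0; lra.
pose A := evaluation_mx u x.
have uA : A \in unitmx by rewrite unitmxE unitfE.
exists x, (fun i j => invmx A j i); split.
  move=> _ [c _ <-] t.
  pose a : 'cV_n := \col_i c i; pose e := evaluation_mx u (fun _ : 'I_1 => t).
  have aE z : lincomb u c z = lincomb u (a ^~ 0) z.
    by apply: eq_bigr => i _; rewrite mxE.
  rewrite aE (lincomb_evaluation u (fun _ : 'I_1 => t) a 0) -/e.
  rewrite -[e](mulmxKV uA) -(mulmxA (e *m invmx A)) mxE; apply: eq_bigr => i _.
  rewrite mulrC aE lincomb_evaluation; congr (_ * _).
  by rewrite mxE; apply: eq_bigr => j _; rewrite mxE mulrC.
move=> i t; pose x' k := if k == i then t else x k.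
have -> : lincomb u (fun j => invmx A j i) t = D x' / D x.
  (* both sides expand along row [i], where the cofactors of the two matrices agree *)
  rewrite /D (expand_det_row _ i) mulr_suml; apply: eq_bigr => j _.
  rewrite !mxE /x' eqxx /invmx uA !mxE -/(D x) mulrC.
  rewrite -[RHS]mulrA [cofactor _ _ _ / _]mulrC; congr (_ * (_ * _)).
  rewrite /cofactor; congr (_ * \det _); apply/matrixP => k k'.
  by rewrite !mxE ?/x' [lift _ _ == _]eq_sym (negbTE (neq_lift _ _)).
rewrite normrM normfV ler_pdivrMr ?normr_gt0//.
exact: le_trans (leS x') Dx.
Qed.

(** A function is determined, with a control of order [n], by its values at [n]
points; these values are rounded to a grid of step [delta / (2 n)]. *)
Lemma exists_interpolation_net n (u : 'I_n -> T -> R) (M K delta : R) (G : nat) :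
  (0 < n)%N -> 0 < delta ->
  (forall i x, `|u i x| <= M) ->
  (forall c, (forall x, lincomb u c x = 0) -> forall i, c i = 0) ->
  4 * n%:R * K / delta < G%:R ->
  exists y : 'I_(G ^ n) -> T -> R,
    (forall i, fun_span u (y i)) /\
    forall f, fun_span u f -> (forall t, `|f t| <= K) ->
      exists i, forall t, `|f t - y i t| <= delta.
Proof.
move=> n0 d0 uM ind KG.
have [x [l [lag l2]]] := exists_near_lagrange_basis uM ind.
have n0' : 0 < n%:R :> R by rewrite ltr0n.
pose eta := delta / (2 * n%:R).
have eta0 : 0 < eta by rewrite divr_gt0// mulr_gt0.
pose val (z : {ffun 'I_n -> 'I_G}) i : R := - K + (z i)%:R * eta.
pose y z t := \sum_i val z i * lincomb u (l i) t.
have cardE : #|{ffun 'I_n -> 'I_G}| = (G ^ n)%N by rewrite card_ffun !card_ord.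
exists (fun i => y (enum_val (cast_ord (esym cardE) i))); split.
  move=> i; set z := enum_val _; exists (fun j => \sum_i val z i * l i j) => //.
  apply/funext => t; rewrite /y /lincomb.
  under [RHS]eq_bigr do rewrite mulr_sumr.
  rewrite exchange_big/=; apply: eq_bigr => j _; rewrite mulr_suml.
  by apply: eq_bigr => k _; rewrite mulrA.
move=> f fu fK; pose r i := (f (x i) + K) / eta.
have r0 i : 0 <= r i.
  by rewrite divr_ge0 ?(ltW eta0)//; have := fK (x i); rewrite ler_norml => /andP[]; lra.
have rG i : (Num.truncn (r i) < G)%N.
  rewrite truncn_lt_nat//; apply: le_lt_trans KG.
  rewrite ler_pdivrMr//.
  have -> : 4 * n%:R * K / delta * eta = 2 * K.
    by rewrite /eta; field; rewrite !gt_eqF.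
  by have := fK (x i); rewrite ler_norml => /andP[]; lra.
pose z := [ffun i => Ordinal (rG i)].
exists (cast_ord cardE (enum_rank z)) => t.
rewrite cast_ordK enum_rankK.
rewrite (lag f fu t) /y -sumrB.
apply: le_trans (ler_norm_sum _ _ _) _.
apply: (@le_trans _ _ (\sum_(i < n) eta * 2)); last first.
  rewrite sumr_const card_ord -[leLHS]mulr_natl.
  by rewrite le_eqVlt; apply/orP; left; apply/eqP; rewrite /eta; field; rewrite gt_eqF.
apply: ler_sum => i _; rewrite -mulrBl normrM ler_pM//.
rewrite /val ffunE/=.
have /andP[t1 t2] := truncn_itv (r0 i).
have fE : f (x i) = r i * eta - K by rewrite /r divfK ?gt_eqF//; lra.
have h1 : (Num.truncn (r i))%:R * eta <= r i * eta by rewrite ler_pM2r.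
have h2 : r i * eta <= (Num.truncn (r i)).+1%:R * eta by rewrite ler_pM2r// ltW.
by rewrite ler_norml fE; move: h2; rewrite -natr1 mulrDl mul1r => h2; apply/andP; split; lra.
Qed.
End Interpolation.

(** * Continuous functions, moments and Lebesgue norms *)

Lemma continuous_measurable_borel (R : realType) (T : ptopologicalType) (f : T -> R) :
  continuous f -> measurable_fun setT (f : borel T -> R).
Proof.
move=> cf; apply: (measurability _ (RGenOpens.measurableE R)).
move=> _ [_ [a [b ->] <-]]; rewrite setTI; apply: sub_sigma_algebra.
by move/continuousP : cf; apply; exact: interval_open.
Qed.

Lemma continuous_bounded_on_compact (R : realType) (X : topologicalType) (A : set X)
    (a : A) (g : pointed_subset a -> R) :
  compact A -> continuous g -> exists M, forall x, `|g x| <= M.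
Proof.
move=> cA cg.
have := (@subspace_valL_continuousP X A R g).2 cg.
move=> /continuous_compact/(_ cA)/compact_bounded[M [_ bM]].
exists (M + 1) => x; apply: (bM (M + 1)); first by rewrite ltrDl.
exists (val x); first exact: set_valP.
by rewrite -[in RHS](valLK point g).
Qed.

Section FiniteDimensional.
Context (R : realType) (T : ptopologicalType) (n : nat) (u : 'I_n -> T -> R).

Lemma fun_spanZ a f : fun_span u f -> fun_span u (fun x => a * f x).
Proof.
move=> [c _ <-]; exists (fun i => a * c i) => //; apply/funext => x.
by rewrite /lincomb mulr_sumr; apply: eq_bigr => i _; rewrite mulrA.
Qed.

Lemma fun_spanB f g : fun_span u f -> fun_span u g -> fun_span u (f \- g).
Proof.
move=> [c _ <-] [e _ <-]; exists (fun i => c i - e i) => //; apply/funext => x.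
by rewrite /lincomb /= -sumrB; apply: eq_bigr => i _; rewrite mulrBl.
Qed.

Lemma fun_span_continuous f : (forall i, continuous (u i)) -> fun_span u f ->
  continuous f.
Proof.
move=> cu [c _ <-]; apply: continuous_big => [|i _ x]; first exact: add_continuous.
by apply: cvgMr; exact: cu.
Qed.

Lemma fun_span_bounded f M : (forall i x, `|u i x| <= M) -> fun_span u f ->
  exists M', forall x, `|f x| <= M'.
Proof.
move=> uM [c _ <-]; exists (\sum_i `|c i| * M) => x.
apply: le_trans (ler_norm_sum _ _ _) _; apply: ler_sum => i _.
by rewrite normrM ler_wpM2l.
Qed.

End FiniteDimensional.

Section Moments.
Context d (T : measurableType d) (R : realType) (mu : probability T R).
Implicit Types f g : T -> R.

Lemma Lnorm_moment p f : ('N[mu]_p%:E[EFin \o f] = (\int[mu]_x (`|f x| `^ p)%:E) `^ p^-1)%E.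
Proof. by rewrite unlock /Lnorm; under eq_integral do rewrite /= . Qed.

Lemma moment_fin_num p f M : 0 <= p -> measurable_fun setT f ->
  (forall x, `|f x| <= M) -> (\int[mu]_x (`|f x| `^ p)%:E \is a fin_num)%E.
Proof.
move=> p0 mf fM; rewrite ge0_fin_numE; last by apply: integral_ge0 => x _; rewrite lee_fin powR_ge0.
apply: (@le_lt_trans _ _ (\int[mu]_x (M `^ p)%:E)%E).
  apply: ge0_le_integral => //.
  - by apply/measurable_EFinP; exact: measurable_normr_powR.
  - move=> x _; rewrite lee_fin ge0_ler_powR ?nnegrE//.
    exact: le_trans (normr_ge0 _) (fM x).
by rewrite integral_cst//= [X in (_ * X)%E](@probability_setT _ _ _ mu) mule1 ltry.
Qed.

Lemma momentZ p a f : measurable_fun setT f ->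
  (\int[mu]_x (`|a * f x| `^ p)%:E = (`|a| `^ p)%:E * \int[mu]_x (`|f x| `^ p)%:E)%E.
Proof.
move=> mf; rewrite -ge0_integralZl_EFin ?powR_ge0//.
  by apply: eq_integral => x _; rewrite normrM powRM// EFinM.
by apply/measurable_EFinP; exact: measurable_normr_powR.
Qed.

(** On a probability space the unit sphere of [L_p] lies in the unit ball of [L_q]; this is what
makes a condition on the [L_q] ball usable for the [L_p] norm. *)
Lemma Lnorm_le_of_moment_eq1 p q f : 1 <= q -> q <= p -> measurable_fun setT f ->
  (\int[mu]_x (`|f x| `^ p)%:E = 1)%E -> ('N[mu]_q%:E[EFin \o f] <= 1)%E.
Proof.
move=> q1 qp mf int1.
have q0 : 0 < q by lra.
have p0 : 0 < p by lra.
rewrite Lnorm_moment -(@poweR1r R q^-1); apply: gt0_ler_poweR.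
- by rewrite invr_ge0 ltW.
- by rewrite in_itv/= leey integral_ge0// => x _; rewrite lee_fin powR_ge0.
- by rewrite in_itv/= leey lee01.
have [->|qnp] := eqVneq q p; first by rewrite int1.
have {qnp} qp : q < p by rewrite lt_neqAle qnp.
(* weighted arithmetic-geometric mean inequality *)
have young t : 0 <= t -> t `^ q <= q / p * t `^ p + (1 - q / p).
  move=> t0; have r0 : 0 < p / (p - q) by rewrite divr_gt0// subr_gt0.
  have := @conjugate_powR R (t `^ q) 1 (p / q) (p / (p - q)) (powR_ge0 _ _) ler01
    (divr_gt0 p0 q0) r0.
  rewrite mulr1 powR1 -powRrM mulrCA divff ?gt_eqF// mulr1 !invf_div.
  rewrite -mulrDl addrC subrK divff ?gt_eqF// => /(_ erefl).
  by rewrite mulrC mul1r mulrBl divff ?gt_eqF.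
apply: (@le_trans _ _ (\int[mu]_x (q / p * `|f x| `^ p + (1 - q / p))%:E)%E).
  apply: ge0_le_integral => //.
  - by apply/measurable_EFinP; exact: measurable_normr_powR.
  - apply/measurable_EFinP; apply: measurable_funD => //; apply: measurable_funM => //.
    exact: measurable_normr_powR.
  - by move=> x _; rewrite lee_fin young.
have qp1 : 0 <= 1 - q / p by rewrite subr_ge0 ler_pdivrMr// mul1r ltW.
have qp0 : 0 <= q / p by rewrite divr_ge0 ?ltW.
under eq_integral do rewrite EFinD EFinM.
have mfp : measurable_fun setT (fun x => (`|f x| `^ p)%:E).
  by apply/measurable_EFinP; exact: measurable_normr_powR.
rewrite ge0_integralD//; last 2 first.
- by move=> x _; rewrite mule_ge0// lee_fin powR_ge0.
- exact: measurable_funeM.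
rewrite ge0_integralZl_EFin// int1 integral_cst//=.
rewrite [X in (_ + _ * X)%E](@probability_setT _ _ _ mu) !mule1 -EFinD lee_fin; lra.
Qed.

Lemma Lnorm_le_sup p f c : 1 <= p -> measurable_fun setT f ->
  (forall x, `|f x| <= c) -> ('N[mu]_p%:E[EFin \o f] <= c%:E)%E.
Proof.
move=> p1 mf fc.
have c0 : 0 <= c by exact: le_trans (normr_ge0 (f point)) (fc point).
have p0 : 0 < p by lra.
have -> : c%:E = ((c `^ p)%:E `^ p^-1)%E.
  by rewrite poweR_EFin -powRrM divff ?gt_eqF// powRr1.
rewrite Lnorm_moment; apply: gt0_ler_poweR.
- by rewrite invr_ge0 ltW.
- by rewrite in_itv/= leey integral_ge0// => x _; rewrite lee_fin powR_ge0.
- by rewrite in_itv/= leey lee_fin powR_ge0.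
apply: (@le_trans _ _ (\int[mu]_x (c `^ p)%:E)%E).
  apply: ge0_le_integral => //.
  - by apply/measurable_EFinP; exact: measurable_normr_powR.
  - by move=> x _; rewrite lee_fin ge0_ler_powR ?nnegrE// ltW.
by rewrite integral_cst//= [X in (_ * X)%E](@probability_setT _ _ _ mu) mule1.
Qed.
End Moments.

(** * Nets from Condition EqB *)

Section Entropy.
Context (R : realType) (T : ptopologicalType) (mu : probability (borel T) R).

Lemma uniform_norm_le (f : T -> R) (c : R) :
  (uniform_norm f <= c%:E)%E <-> forall x, `|f x| <= c.
Proof.
split=> [fc x|fc].
  by rewrite -lee_fin; apply: le_trans fc; apply: ereal_sup_ubound; exists x.
by apply: ge_ereal_sup => _ [x _ <-]; rewrite lee_fin.
Qed.

(** An infimum may fail to be attained; doubling the radius takes care of that. *)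
Lemma EqB_net (q B : R) n X k : 0 < B -> EqB mu q B n X -> (1 <= k <= n)%N ->
  exists y : 'I_(2 ^ k) -> T -> R, (forall j, X (y j)) /\
    forall f, Lq_ball mu q X f ->
      exists j, forall x, `|f x - y j x| <= 2 * (B * (n%:R / k%:R) `^ q^-1).
Proof.
move=> B0 eqB kn; have := eqB k kn; set r := B * _.
have r0 : 0 < r.
  case/andP: kn => k1 kn.
  by rewrite mulr_gt0// powR_gt0// divr_gt0// ltr0n// (leq_trans k1 kn).
move=> er; have : (entropy_number k (Lq_ball mu q X) < (2 * r)%:E)%E.
  by apply: le_lt_trans er _; rewrite lte_fin; lra.
move=> /ereal_inf_lt[_ [e [e0 [y [Xy cov]]] <-]]; rewrite lte_fin => er2.
exists y; split; first by move=> j; case: (Xy j).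
move=> f /cov[j _ /= /uniform_norm_le fy]; exists j => x.
by apply: le_trans (fy x) _; exact: ltW.
Qed.

(** Two balls cover the unit ball, so two of the three functions [0], [f] and [-f]
share one of them. *)
Lemma EqB_sup_bound (q B : R) n (u : 'I_n -> T -> R) f :
  0 < q -> 0 < B -> (0 < n)%N -> EqB mu q B n (fun_span u) ->
  Lq_ball mu q (fun_span u) f ->
  forall x, `|f x| <= 4 * B * n%:R `^ q^-1.
Proof.
move=> q0 B0 n0 eqB [Xf f1] x.
have [|y [_ cov]] := EqB_net B0 eqB (k := 1%N); first by rewrite n0.
rewrite divr1 in cov; set r := 2 * _ in cov.
have XZ a : fun_span u (fun x => a * f x) by exact: fun_spanZ.
have [j0 h0] : exists j, forall x, `|0 * f x - y j x| <= r.
  apply: cov; split=> //; rewrite /Lp_norm.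
  rewrite (_ : EFin \o _ = cst 0%E); first by rewrite Lnorm0 ?eqe ?gt_eqF.
  by apply/funext => z /=; rewrite mul0r.
have [j1 h1] : exists j, forall x, `|f x - y j x| <= r by exact: cov.
have [j2 h2] : exists j, forall x, `|-1 * f x - y j x| <= r.
  apply: cov; split=> //; rewrite /Lp_norm.
  rewrite (_ : EFin \o _ = \- (EFin \o f))%E; first by rewrite oppe_Lnorm.
  by apply/funext => z /=; rewrite mulN1r.
have -> : 4 * B * n%:R `^ q^-1 = 2 * r by rewrite /r; ring.
have := h0 x; have := h1 x; have := h2 x.
rewrite mul0r mulN1r !ler_norml.
(* three functions, two balls *)
have pig : [|| j0 == j1, j0 == j2 | j1 == j2].
  by case: j0 j1 j2 {h0 h1 h2} => [[|[|?]]//?] [[|[|?]]//?] [[|[|?]]//?].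
case/or3P: pig => /eqP E; rewrite ?E => /andP[? ?] /andP[? ?] /andP[? ?];
  apply/andP; split; lra.
Qed.
End Entropy.

(** * Sizes of the nets against the number of points *)

Section LevelCosts.
Context (R : realType).
Implicit Types (p q B nq K lam a : R) (n L : nat).

(** [ln (L N)] is of order [n lam] here, and [n (8 B) `^ p <= (2 K) `^ p]
since [n = nq `^ q <= nq `^ p]. *)
Lemma low_level_cost p q B nq K lam n L a :
  1 <= q -> q <= p -> 1 <= B -> (0 < n)%N -> (0 < L)%N ->
  1 <= nq -> nq <= n%:R -> nq `^ q = n%:R -> K = 4 * B * nq ->
  lam = ln (2 * B * n%:R) -> 2^-1 <= lam -> L%:R <= 16 * lam -> 0 < a -> a <= 8 * B ->
  L%:R * (a `^ p * ln (L%:R * ((Num.truncn (32 * n%:R * K)).+1 ^ n)%:R))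
    <= 16 * 84 * (lam ^+ 2 * (2 * K) `^ p).
Proof.
move=> q1 qp B1 n0 L0 nq1 nqn nqq KE lamE lam2 Llam a0 aB.
have p0 : 0 < p by lra.
have n1 : 1 <= n%:R :> R by rewrite ler1n.
have L1 : 1 <= L%:R :> R by rewrite ler1n.
have lnL : ln L%:R <= L%:R :> R by apply: ln_le_id; lra.
have E_ge0 : 0 <= (2 * K) `^ p by exact: powR_ge0.
set E := (2 * K) `^ p in E_ge0 *.
have K1 : 4 <= K by rewrite KE; nra.
have r0 : 0 <= 32 * n%:R * K by rewrite !mulr_ge0//; lra.
have /andP[tr1 _] := truncn_itv r0.
have Gnat : (Num.truncn (32 * n%:R * K)).+1%:R <= 32 * n%:R * K + 1.
  by rewrite -natr1 lerD2r.
move: (Num.truncn _).+1 Gnat => G Gr {tr1}.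
(* [G] is generalised away from its definition, hence this degenerate case *)
have [->|G0'] := eqVneq G 0%N.
  rewrite exp0n; last exact: n0.
  have lamE0 : 0 <= lam ^+ 2 * E by rewrite mulr_ge0 ?sqr_ge0.
  by rewrite mulr0 ln0// !mulr0 mulr_ge0.
have G0 : 0 < G%:R :> R by rewrite ltr0n lt0n.
pose x := 2 * B * n%:R.
have x2 : 2 <= x by rewrite /x; nra.
have GB : G%:R <= 33 * x ^+ 2.
  have h1 : n%:R * K <= n%:R * (4 * B * n%:R).
    by rewrite ler_pM2l ?ltr0n// KE ler_pM2l//; lra.
  have h2 : 1 <= n%:R * K.
    by rewrite -[leLHS]mulr1 ler_pM//; lra.
  have h3 : n%:R * (4 * B * n%:R) <= x ^+ 2.
    have -> : x ^+ 2 = n%:R * (4 * B * n%:R) * B by rewrite /x; ring.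
    by rewrite ler_peMr// !mulr_ge0//; lra.
  by clear - Gr h1 h2 h3; lra.
have lnG : ln G%:R <= 68 * lam.
  apply: le_trans (_ : ln (33 * x ^+ 2) <= _).
    by rewrite ler_ln ?posrE// mulr_gt0// exprn_gt0//; lra.
  have x0 : 0 < x by lra.
  rewrite lnM ?posrE ?exprn_gt0// lnXn// /x -lamE -[_ *+ 2]mulr_natl.
  by have := @ln_le_id R 33; clear - lam2; lra.
have nE : n%:R * (8 * B) `^ p <= E.
  have -> : E = nq `^ p * (8 * B) `^ p.
    by rewrite /E KE -powRM; [congr (_ `^ _); ring|lra..].
  by rewrite ler_wpM2r ?powR_ge0// -nqq ler_powR.
have apB : a `^ p <= (8 * B) `^ p.
  by rewrite ge0_ler_powR ?nnegrE ?(ltW p0)//; lra.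
rewrite natrX lnM ?posrE ?exprn_gt0 ?(lt_le_trans ltr01 L1)// lnXn// -[_ *+ n]mulr_natl.
have h1 : ln L%:R + n%:R * ln G%:R <= n%:R * (84 * lam).
  have : n%:R * ln G%:R <= n%:R * (68 * lam) by rewrite ler_wpM2l.
  have : lam <= n%:R * lam by rewrite ler_peMl//; lra.
  by clear - lnL Llam; lra.
have h2 : a `^ p * (ln L%:R + n%:R * ln G%:R) <= 84 * (lam * E).
  apply: (@le_trans _ _ (a `^ p * (n%:R * (84 * lam)))).
    by rewrite ler_wpM2l ?powR_ge0.
  apply: (@le_trans _ _ ((8 * B) `^ p * (n%:R * (84 * lam)))).
    by rewrite ler_wpM2r// !mulr_ge0//; lra.
  have -> : (8 * B) `^ p * (n%:R * (84 * lam)) = 84 * lam * (n%:R * (8 * B) `^ p) by ring.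
  by rewrite [84 * (lam * E)]mulrA ler_wpM2l//; lra.
apply: (@le_trans _ _ (L%:R * (84 * (lam * E)))); first by rewrite ler_wpM2l.
have -> : 16 * 84 * (lam ^+ 2 * E) = 16 * lam * (84 * (lam * E)) by ring.
by rewrite ler_wpM2r// !mulr_ge0//; lra.
Qed.

(** Above height [8 B] the index [k] demanded by the radius [a / 4] is still at
most [n], where Condition EqB applies. *)
Lemma high_level_index q B nq K n a :
  0 < q -> 1 <= B -> (0 < n)%N -> 1 <= nq -> nq `^ q = n%:R -> K = 4 * B * nq -> 8 * B < a ->
  exists k, [/\ (1 <= k <= n)%N, n%:R <= k%:R * (a / (8 * B)) `^ q
    & k%:R <= (2 * K / a) `^ q + 1].
Proof.
move=> q0 B1 n0 nq1 nqq KE Ba; have a0 : 0 < a by lra.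
have Ba0 : 0 <= 8 * B / a by rewrite divr_ge0//; lra.
pose X := n%:R * (8 * B / a) `^ q.
have XE : X = (2 * K / a) `^ q.
  rewrite /X -nqq -powRM//; last lra.
  by congr (_ `^ _); rewrite KE; field; rewrite gt_eqF.
have X0 : 0 <= X by rewrite mulr_ge0 ?powR_ge0.
have /andP[tr1 tr2] := truncn_itv X0.
exists (Num.truncn X).+1; split.
- rewrite /= truncn_lt_nat// -[ltRHS]mulr1 ltr_pM2l ?ltr0n//.
  rewrite -[ltRHS](@base1_powR R q).
  by apply: gt0_ltr_powR; rewrite ?nnegrE// ltr_pdivrMr// mul1r.
- have inv1 : (8 * B / a) `^ q * (a / (8 * B)) `^ q = 1.
    rewrite -powRM//; last by rewrite divr_ge0//; lra.
    by rewrite mulrA divfK ?divff ?base1_powR// gt_eqF//; lra.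
  have -> : n%:R = X * (a / (8 * B)) `^ q by rewrite /X -mulrA inv1 mulr1.
  by rewrite ler_wpM2r ?powR_ge0// ltW.
- by rewrite -natr1 -XE lerD2r.
Qed.

(** With [s = 2 K / a >= 1] one has [k <= s `^ q + 1 <= 2 s `^ p], and
[a `^ p * s `^ p] does not depend on [a]: this is where [q <= p] is used. *)
Lemma high_level_cost p q K lam L a k :
  1 <= q -> q <= p -> (0 < L)%N -> 2^-1 <= lam -> L%:R <= 16 * lam -> 0 < a -> a <= K -> (0 < k)%N ->
  k%:R <= (2 * K / a) `^ q + 1 ->
  L%:R * (a `^ p * ln (L%:R * (2 ^ k)%:R)) <= 16 * 84 * (lam ^+ 2 * (2 * K) `^ p).
Proof.
move=> q1 qp L0 lam2 Llam a0 aK k0 kX.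
have p0 : 0 < p by lra.
have L1 : 1 <= L%:R :> R by rewrite ler1n.
have lnL : ln L%:R <= L%:R :> R by apply: ln_le_id; lra.
have E_ge0 : 0 <= (2 * K) `^ p by exact: powR_ge0.
set E := (2 * K) `^ p in E_ge0 *.
pose s := 2 * K / a.
have s1 : 1 <= s by rewrite /s ler_pdivlMr// mul1r; lra.
have sp : k%:R <= 2 * s `^ p.
  have h1 : s `^ q <= s `^ p by exact: ler_powR.
  have h2 : 1 <= s `^ p.
    by rewrite -[leLHS](@base1_powR R p) ge0_ler_powR ?nnegrE ?(ltW p0)//; lra.
  by move: kX; rewrite -/s; clear - h1 h2; lra.
have asE : a `^ p * s `^ p = E.
  rewrite -powRM; [|lra..]; congr (_ `^ _).
  by rewrite /s mulrC divfK// gt_eqF.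
have apE : a `^ p <= E by rewrite /E ge0_ler_powR ?nnegrE ?(ltW p0)//; lra.
rewrite natrX lnM ?posrE ?exprn_gt0 ?(lt_le_trans ltr01 L1)// lnXn// -[_ *+ k]mulr_natl.
have ln2 : k%:R * ln 2 <= k%:R :> R.
  by rewrite ler_piMr// -[2]/(1 + 1); apply: le_ln1Dx; lra.
have h1 : a `^ p * (ln L%:R + k%:R * ln 2) <= 3 * L%:R * E.
  apply: (@le_trans _ _ (a `^ p * (L%:R + 2 * s `^ p))).
    by rewrite ler_wpM2l ?powR_ge0//; clear - lnL ln2 sp; lra.
  rewrite mulrDr mulrCA asE.
  have : a `^ p * L%:R <= E * L%:R by rewrite ler_wpM2r.
  have : E <= E * L%:R by rewrite ler_peMr.
  clear; lra.
apply: (@le_trans _ _ (L%:R * (3 * L%:R * E))); first by rewrite ler_wpM2l.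
have h2 : L%:R * L%:R <= 256 * lam ^+ 2.
  have -> : 256 * lam ^+ 2 = (16 * lam) * (16 * lam) by ring.
  by apply: ler_pM.
have h3 : L%:R * L%:R * E <= 256 * lam ^+ 2 * E by rewrite ler_wpM2r.
have h4 : 0 <= lam ^+ 2 * E by rewrite mulr_ge0// sqr_ge0.
by clear - h3 h4; lra.
Qed.
End LevelCosts.

Lemma le_sample_size (R : realType) (p q B : R) (n : nat) :
  1 <= q -> q <= p -> 1 <= B -> (0 < n)%N ->
  n%:R <= 8 * 16 * 84 * 16 `^ p * B `^ p * n%:R `^ (p / q) * ln (2 * B * n%:R) ^+ 2.
Proof.
move=> q1 qp B1 n0.
have q0 : 0 < q by exact: lt_le_trans ltr01 _.
have n1 : 1 <= n%:R :> R by rewrite ler1n.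
have powp_ge1 (b : R) : 1 <= b -> 1 <= b `^ p.
  by move=> b1; rewrite (le_trans b1)// le_powR_id//; exact: le_trans qp.
have nn : n%:R <= n%:R `^ (p / q) :> R.
  by rewrite le_powR_id// ler_pdivlMr// mul1r.
have lnz : 2^-1 <= ln (2 * B * n%:R).
  apply: le_trans (ln2_ge_half R) _; rewrite ler_ln ?posrE//; clear - n1 B1; nra.
have lnz2 : 2^-1 ^+ 2 <= ln (2 * B * n%:R) ^+ 2.
  by rewrite ler_sqr ?nnegrE// (le_trans _ lnz).
have nE : n%:R = 4 * 1 * 1 * n%:R * 2^-1 ^+ 2 :> R by field.
rewrite [leLHS]nE !ler_pM ?mulr_ge0 ?exprn_ge0 ?powR_ge0//; first lra.
- by apply: powp_ge1; lra.
- exact: powp_ge1.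
Qed.

(** * One-sided discretization under Condition EqB *)

Section OneSidedDiscretization.
Context (R : realType) (T : ptopologicalType) (mu : probability (borel T) R).

(** The index [k] of an entropy net is limited to [k <= n], which separates the
heights at [8 B]. *)
Lemma EqB_exists_level_net (p q B M : R) (n : nat) (u : 'I_n -> T -> R)
    (L j : nat) (nq K lam : R) :
  1 <= q -> q <= p -> 1 <= B -> (0 < n)%N -> (0 < L)%N ->
  (forall i x, `|u i x| <= M) ->
  (forall c, (forall x, lincomb u c x = 0) -> forall i, c i = 0) ->
  EqB mu q B n (fun_span u) ->
  nq = n%:R `^ q^-1 -> K = 4 * B * nq -> lam = ln (2 * B * n%:R) ->
  2^-1 <= lam -> L%:R <= 16 * lam -> 2 ^+ j / 2 <= K ->
  exists (N : nat) (y : 'I_N -> T -> R), [/\ (0 < N)%N,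
    forall i, fun_span u (y i),
    forall f, Lq_ball mu q (fun_span u) f ->
      exists i, forall x, `|f x - y i x| <= 2 ^+ j / 8
  & L%:R * ((2 ^+ j / 2) `^ p * ln (L%:R * N%:R)) <= 16 * 84 * (lam ^+ 2 * (2 * K) `^ p)].
Proof.
move=> q1 qp B1 n0 L0 uM ind eqB nqE KE lamE lam2 Llam aK.
have q0 : 0 < q by lra.
have B0 : 0 < B by lra.
have n1 : 1 <= n%:R :> R by rewrite ler1n.
have nq1 : 1 <= nq.
  by rewrite nqE -[leLHS](@base1_powR R q^-1) ge0_ler_powR ?nnegrE// invr_ge0 ltW.
have nqn : nq <= n%:R.
  by rewrite nqE -[leRHS](@powRr1 R) ?ler0n// ler_powR// invf_le1.
have nqq : nq `^ q = n%:R by rewrite nqE -powRrM mulVf ?gt_eqF// powRr1.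
have a2 : 2^-1 <= 2 ^+ j / 2 :> R.
  by rewrite -[leLHS]div1r ler_pM2r ?invr_gt0// exprn_ege1// ler1n.
have -> : 2 ^+ j / 8 = 2 ^+ j / 2 / 4 :> R by field.
move: (2 ^+ j / 2) aK a2 => a aK a2.
have a0 : 0 < a by lra.
have [aB|Ba] := leP a (8 * B).
  have rG : 4 * n%:R * K / 8^-1 < (Num.truncn (32 * n%:R * K)).+1%:R.
    have := truncnS_gt (32 * n%:R * K); move: (Num.truncn _).+1 => G.
    by rewrite invrK; lra.
  have d0 : 0 < 8^-1 :> R by rewrite invr_gt0.
  have [y [yu ycov]] := exists_interpolation_net n0 d0 uM ind rG.
  exists _, y; split.
  - by rewrite expn_gt0.
  - exact: yu.
  - move=> f fb; have [|i hi] := ycov f (proj1 fb).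
      by move=> t; rewrite KE nqE; exact: (EqB_sup_bound q0 B0 n0 eqB fb).
    by exists i => x; apply: le_trans (hi x) _; clear - a2; lra.
  - exact: (low_level_cost q1 qp B1 n0 L0 nq1 nqn nqq KE lamE).
have [k [kn kq kX]] := high_level_index q0 B1 n0 nq1 nqq KE Ba.
have k0 : 0 < k%:R :> R by rewrite ltr0n; case/andP: kn.
have [y [yu ycov]] := EqB_net B0 eqB kn.
exists _, y; split.
- by rewrite expn_gt0.
- exact: yu.
- move=> f fb; have [i hi] := ycov f fb.
  exists i => x; apply: le_trans (hi x) _.
  have : (n%:R / k%:R) `^ q^-1 <= a / (8 * B).
    have aB0 : 0 <= a / (8 * B) by rewrite divr_ge0//; lra.
    have -> : a / (8 * B) = ((a / (8 * B)) `^ q) `^ q^-1.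
      by rewrite -powRrM divff ?gt_eqF// powRr1.
    apply: ge0_ler_powR; rewrite ?nnegrE ?powR_ge0 ?invr_ge0 ?(ltW q0)//.
    by rewrite ler_pdivrMr// mulrC.
  move=> /(ler_wpM2l (ltW B0)); have -> : B * (a / (8 * B)) = a / 8.
    by field; rewrite gt_eqF.
  by clear; lra.
- apply: (high_level_cost q1 qp L0 lam2 Llam a0 aK _ kX).
  by case/andP: kn.
Qed.

(** In the condition on [m], the factor [16 * 84] comes from the costs of the levels,
[8 * 2 `^ p] from [discretization_of_nets], and the remaining [8 `^ p] from
[(2 * K) `^ p = 8 `^ p * B `^ p * n%:R `^ (p / q)]. *)
Lemma EqB_discretization_sphere (p q B M : R) (n m : nat) (u : 'I_n -> T -> R) :
  1 <= q -> q <= p -> 1 <= B -> (0 < n)%N ->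
  (forall i, continuous (u i)) -> (forall i x, `|u i x| <= M) ->
  (forall c, (forall x, lincomb u c x = 0) -> forall i, c i = 0) ->
  EqB mu q B n (fun_span u) ->
  8 * 16 * 84 * 16 `^ p * B `^ p * n%:R `^ (p / q) * ln (2 * B * n%:R) ^+ 2 <= m%:R ->
  exists xi : 'I_m -> T, forall f, fun_span u f ->
    (\int[mu]_x (`|f x| `^ p)%:E = 1)%E ->
    (2 `^ p)^-1 ^+ 2 / 16 * m%:R <= \sum_(s < m) `|f (xi s)| `^ p.
Proof.
move=> q1 qp B1 n0 cu uM ind eqB hm.
have q0 : 0 < q by lra.
have p0 : 0 < p by lra.
have B0 : 0 < B by lra.
have n1 : 1 <= n%:R :> R by rewrite ler1n.
have [lam lamE] : exists lam, lam = ln (2 * B * n%:R) by eexists.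
have [nq nqE] : exists nq, nq = n%:R `^ q^-1 by eexists.
have [K KE] : exists K, K = 4 * B * nq by eexists.
have nq1 : 1 <= nq.
  by rewrite nqE -[leLHS](@base1_powR R q^-1) ge0_ler_powR ?nnegrE// invr_ge0 ltW.
have nqn : nq <= n%:R.
  by rewrite nqE -[leRHS](@powRr1 R) ?ler0n// ler_powR// invf_le1.
have z2 : 2 <= 2 * B * n%:R by nra.
have K4 : 4 <= K by rewrite KE; nra.
have Kz : 2 * K <= 4 * (2 * B * n%:R).
  have : B * nq <= B * n%:R by rewrite ler_wpM2l// ltW.
  by rewrite KE; clear; lra.
have lam2 : 2^-1 <= lam.
  by rewrite lamE; apply: le_trans (ln2_ge_half R) _; rewrite ler_ln ?posrE//; lra.
have [|L [L0 LK Llam aK]] := exists_dyadic_levels _ z2 Kz; first lra.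
rewrite -lamE in Llam hm.
have target : 16 * 84 * (lam ^+ 2 * (2 * K) `^ p) <= m%:R * (2 `^ p)^-1 / 8.
  have two0 : 0 < 2 `^ p :> R by exact: powR_gt0.
  rewrite ler_pdivlMr// ler_pdivlMr//; apply: le_trans hm.
  have -> : (2 * K) `^ p = 8 `^ p * B `^ p * n%:R `^ (p / q).
    rewrite KE (_ : 2 * (4 * B * nq) = 8 * B * nq); last ring.
    rewrite !powRM ?mulr_ge0 ?(ltW B0)//; last lra.
    by rewrite nqE -powRrM [q^-1 * p]mulrC.
  have -> : 16 `^ p = 8 `^ p * 2 `^ p :> R.
    by rewrite -powRM//; congr (_ `^ _); ring.
  by rewrite le_eqVlt; apply/orP; left; apply/eqP; ring.
pose A := [set f | fun_span u f /\ (\int[mu]_x (`|f x| `^ p)%:E = 1)%E].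
have mspan f : fun_span u f -> measurable_fun setT (f : borel T -> R).
  by move=> uf; apply: continuous_measurable_borel; exact: fun_span_continuous uf.
have Aball f : A f -> Lq_ball mu q (fun_span u) f.
  by move=> [uf f1]; split=> //; apply: Lnorm_le_of_moment_eq1 f1 => //; exact: mspan.
have AK f x : A f -> `|f x| <= K.
  by move=> /Aball Af; rewrite KE nqE; exact: (EqB_sup_bound q0 B0 n0 eqB Af).
pose S := {N : nat & 'I_N -> T -> R}.
have : forall j : 'I_L, exists s : S, [/\ (0 < tag s)%N,
    forall i, fun_span u (tagged s i),
    forall f, A f -> exists i, forall x, `|f x - tagged s i x| <= 2 ^+ j / 8
  & L%:R * ((2 ^+ j / 2) `^ p * ln (L%:R * (tag s)%:R)) <= m%:R * (2 `^ p)^-1 / 8].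
  move=> j; have [N [y [N0 yu ycov cost]]] := EqB_exists_level_net q1 qp B1 n0 L0 uM
    ind eqB nqE KE lamE lam2 Llam (aK j (ltn_ord j)).
  exists (Tagged (fun N => 'I_N -> T -> R) y); split=> //=.
  - by move=> f /Aball; exact: ycov.
  - exact: le_trans cost target.
move=> /choice[s hs].
have [||||||xi hxi] := @discretization_of_nets _ (borel T) R mu p m L A
  (fun j => tag (s j)) (fun j => tagged (s j)).
- lra.
- by move=> j; case: (hs j).
- by move=> j i; apply: mspan; case: (hs j).
- move=> f Af; split; first by apply: mspan; case: Af.
  by move=> x; apply: le_lt_trans LK; exact: AK.
- by move=> f j Af; case: (hs j) => _ _ /(_ f Af).
- by move=> j; case: (hs j).
by exists xi => f uf f1; apply: hxi.
Qed.

(** By homogeneity this reduces to the unit sphere; 64 bounds [(16 * 4 `^ p) `^ p^-1]. *)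
Lemma EqB_discretization (p q B M : R) (n m : nat) (u : 'I_n -> T -> R) :
  1 <= q -> q <= p -> 1 <= B -> (0 < n)%N ->
  (forall i, continuous (u i)) -> (forall i x, `|u i x| <= M) ->
  (forall c, (forall x, lincomb u c x = 0) -> forall i, c i = 0) ->
  EqB mu q B n (fun_span u) ->
  8 * 16 * 84 * 16 `^ p * B `^ p * n%:R `^ (p / q) * ln (2 * B * n%:R) ^+ 2 <= m%:R ->
  exists xi : 'I_m -> T, forall f, fun_span u f ->
    (Lp_norm mu p f <= (64 * discrete_norm p xi f)%:E)%E.
Proof.
move=> q1 qp B1 n0 cu uM ind eqB hm.
have p0 : 0 < p by lra.
have m0 : 0 < m%:R :> R.
  have n1 : 1 <= n%:R :> R by rewrite ler1n.
  have n_gt0 : 0 < n%:R :> R by lra.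
  have B_gt0 : 0 < B by lra.
  have ln_z : 0 < ln (2 * B * n%:R).
    by apply: ln_gt0; clear - n1 B1; nra.
  by apply: lt_le_trans hm; rewrite !mulr_gt0 ?powR_gt0.
have [xi hxi] := EqB_discretization_sphere q1 qp B1 n0 cu uM ind eqB hm.
exists xi => f uf; have mf : measurable_fun setT (f : borel T -> R).
  by apply: continuous_measurable_borel; exact: fun_span_continuous uf.
have [M' fM] := fun_span_bounded uM uf.
have Ifin := moment_fin_num mu (ltW p0) mf fM.
have I0 : (0 <= \int[mu]_x (`|f x| `^ p)%:E)%E.
  by apply: integral_ge0 => x _; rewrite lee_fin powR_ge0.
have D0 : 0 <= discrete_norm p xi f by exact: powR_ge0.
rewrite /Lp_norm Lnorm_moment.
have [v vE] : exists v, (\int[mu]_x (`|f x| `^ p)%:E = v%:E)%E.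
  by exists (fine (\int[mu]_x (`|f x| `^ p)%:E)); rewrite fineK.
rewrite vE lee_fin in I0; rewrite vE poweR_EFin lee_fin.
have [->|v0] := eqVneq v 0.
  by rewrite powR0 ?invr_eq0 ?gt_eqF// mulr_ge0.
have {v0}vp : 0 < v by rewrite lt_neqAle eq_sym v0.
have [w wE] : exists w, w = v `^ p^-1 by eexists.
have wp : w `^ p = v by rewrite wE -powRrM mulVf ?gt_eqF// powRr1// ltW.
have w0 : 0 < w by rewrite wE powR_gt0.
rewrite -wE.
have := hxi _ (fun_spanZ w^-1 uf).
rewrite momentZ// vE ger0_norm ?invr_ge0 ?(ltW w0)//.
have winvp : w^-1 `^ p = v^-1.
  by rewrite -powR_inv1 ?(ltW w0)// -powRrM mulrC powRrM wp powR_inv1// ltW.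
rewrite winvp -EFinM mulVf ?gt_eqF// => /(_ erefl).
under eq_bigr do rewrite normrM powRM// ger0_norm ?invr_ge0 ?(ltW w0)// winvp.
rewrite -mulr_sumr ler_pdivlMl//; set s := \sum_(_ < _) _ => hs.
have s0 : 0 <= s by apply: sumr_ge0 => i _; exact: powR_ge0.
have Dp : discrete_norm p xi f `^ p = m%:R^-1 * s.
  rewrite /discrete_norm -powRrM mulVf ?gt_eqF// powRr1//.
  by rewrite mulr_ge0// invr_ge0 ltW.
rewrite leNgt; apply/negP => lt_w.
have : (64 * discrete_norm p xi f) `^ p < w `^ p.
  by apply: gt0_ltr_powR => //; rewrite nnegrE ?mulr_ge0// ltW.
rewrite wp powRM// Dp ltNge => /negP; apply.
have c64 : 16 * (2 `^ p) ^+ 2 <= 64 `^ p :> R.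
  have -> : 64 = 16 * (2 * 2) :> R by ring.
  rewrite !powRM// -expr2 ler_wpM2r ?sqr_ge0//.
  by rewrite -[leLHS](@powRr1 R)// ler_powR//; lra.
have t0 : 0 < 2 `^ p :> R by exact: powR_gt0.
apply: (@le_trans _ _ (16 * (2 `^ p) ^+ 2 * (m%:R^-1 * s))); last first.
  by rewrite ler_wpM2r// mulr_ge0// invr_ge0 ltW.
move: t0 hs; move: (2 `^ p) => t t0 hs.
have -> : 16 * t ^+ 2 * (m%:R^-1 * s) = (t^-1 ^+ 2 / 16 * m%:R)^-1 * s.
  by field; rewrite !gt_eqF.
by rewrite ler_pdivlMl ?mulr_gt0 ?divr_gt0 ?exprn_gt0 ?invr_gt0// mulrC.
Qed.
End OneSidedDiscretization.

(** * Recovery *)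

Section Recovery.
Context (R : realType) (T : ptopologicalType) (mu : probability (borel T) R).

(** The crude inequality [`|s - t| `^ p <= 2 `^ p * (`|s| `^ p + `|t| `^ p)] costs
only a constant, and spares a discrete Minkowski inequality. *)
Lemma discrete_norm_recovery_le (p c : R) m (xi : 'I_m -> T) (f g v : T -> R) :
  1 <= p -> (0 < m)%N -> (forall x, `|f x - g x| <= c) ->
  discrete_norm p xi (f \- v) <= discrete_norm p xi (f \- g) ->
  discrete_norm p xi (g \- v) <= 4 * c.
Proof.
move=> p1 m0 fg opt.
have p0 : 0 < p by exact: lt_le_trans ltr01 p1.
have c0 : 0 <= c by exact: le_trans (normr_ge0 _) (fg point).
have m0' : 0 < m%:R :> R by rewrite ltr0n.
pose S (h : T -> R) := \sum_(j < m) `|h (xi j)| `^ p.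
have S0 h : 0 <= m%:R^-1 * S h.
  by rewrite mulr_ge0 ?invr_ge0// sumr_ge0// => i _; exact: powR_ge0.
have DE h : discrete_norm p xi h `^ p = m%:R^-1 * S h.
  by rewrite /discrete_norm -powRrM mulVf ?gt_eqF// powRr1//; exact: S0.
have Sfg : S (f \- g) <= m%:R * c `^ p.
  apply: (@le_trans _ _ (\sum_(j < m) c `^ p)).
    by apply: ler_sum => j _; rewrite ge0_ler_powR ?nnegrE ?(ltW p0)//; exact: fg.
  by rewrite sumr_const card_ord -[leLHS]mulr_natl.
have Sfv : S (f \- v) <= S (f \- g).
  rewrite -(@ler_pM2l _ m%:R^-1) ?invr_gt0// -!DE.
  by rewrite ge0_ler_powR ?nnegrE ?powR_ge0 ?(ltW p0).
have Sgv : S (g \- v) <= 2 `^ p * (S (f \- v) + S (f \- g)).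
  rewrite mulrDr !mulr_sumr -big_split/=; apply: ler_sum => j _.
  have -> : (g \- v) (xi j) = (f (xi j) - v (xi j)) - (f (xi j) - g (xi j)).
    by rewrite /=; ring.
  move: (f (xi j) - v (xi j)) (f (xi j) - g (xi j)) => s t.
  rewrite -!powRM//.
  have le2 (a b : R) : `|a| <= `|b| -> `|a - b| <= 2 * `|b|.
    by move=> ab; rewrite (le_trans (ler_normB _ _))// mulr_natl mulr2n lerD2r.
  have [st|/ltW ts] := leP `|s| `|t|.
    apply: (@le_trans _ _ ((2 * `|t|) `^ p)); last by rewrite lerDr powR_ge0.
    by rewrite ge0_ler_powR ?nnegrE ?(ltW p0) ?mulr_ge0//; exact: le2.
  apply: (@le_trans _ _ ((2 * `|s|) `^ p)); last by rewrite lerDl powR_ge0.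
  by rewrite ge0_ler_powR ?nnegrE ?(ltW p0) ?mulr_ge0// distrC; exact: le2.
rewrite leNgt; apply/negP => lt_D.
have : (4 * c) `^ p < discrete_norm p xi (g \- v) `^ p.
  have c_nneg : 4 * c \is Num.nneg by rewrite nnegrE mulr_ge0.
  have D_nneg : discrete_norm p xi (g \- v) \is Num.nneg by rewrite nnegrE; exact: powR_ge0.
  exact: gt0_ltr_powR p0 _ _ c_nneg D_nneg lt_D.
rewrite DE ltNge => /negP; apply.
rewrite ler_pdivrMl//.
have -> : (4 * c) `^ p = 2 `^ p * (2 `^ p * c `^ p).
  by rewrite -!powRM ?mulr_ge0//; congr (_ `^ _); ring.
have two : 2 * c `^ p <= 2 `^ p * c `^ p.
  rewrite ler_wpM2r ?powR_ge0//.
  by rewrite le_powR_id// ler1n.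
apply: le_trans Sgv _; rewrite mulrCA ler_wpM2l ?powR_ge0//.
apply: le_trans (_ : m%:R * (2 * c `^ p) <= _); last by rewrite ler_wpM2l.
by clear - Sfv Sfg; lra.
Qed.

Lemma recovery_error_le (p c k : R) m (xi : 'I_m -> T) n (u : 'I_n -> T -> R) (f g v : T -> R) :
  1 <= p -> (0 < m)%N -> 0 <= k ->
  (forall i, continuous (u i)) -> continuous f ->
  (forall h, fun_span u h -> (Lp_norm mu p h <= (k * discrete_norm p xi h)%:E)%E) ->
  fun_span u g -> fun_span u v -> (forall x, `|f x - g x| <= c) ->
  discrete_norm p xi (f \- v) <= discrete_norm p xi (f \- g) ->
  (Lp_norm mu p (f \- v)%R <= ((1 + k * 4) * c)%:E)%E.
Proof.
move=> p1 m0 k0 cu cf disc ug uv fg opt.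
have mspan h : fun_span u h -> measurable_fun setT (h : borel T -> R).
  by move=> uh; apply: continuous_measurable_borel; exact: fun_span_continuous uh.
have mf := continuous_measurable_borel cf.
have -> : f \- v = (f \- g) \+ (g \- v) by apply/funext => x /=; ring.
have mfg : measurable_fun setT ((f \- g)%R : borel T -> R).
  by apply: measurable_funB => //; exact: mspan.
have mgv : measurable_fun setT ((g \- v)%R : borel T -> R).
  by apply: mspan; exact: fun_spanB.
apply: le_trans (minkowski_EFin mu mfg mgv p1) _.
rewrite mulrDl mul1r EFinD; apply: leeD; first exact: Lnorm_le_sup.
apply: le_trans (disc _ (fun_spanB ug uv)) _.
rewrite lee_fin -mulrA ler_wpM2l//.
exact: discrete_norm_recovery_le opt.
Qed.

(** Condition EqB excludes nonzero functions of [X] that vanish almost everywhere: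
all their multiples would lie in the [L_q] ball, which is uniformly bounded. *)
Lemma EqB_subspace_Lp (p q B M : R) n (u : 'I_n -> T -> R) :
  1 <= p -> 0 < q -> 0 < B -> (0 < n)%N ->
  (forall i, continuous (u i)) -> (forall i x, `|u i x| <= M) ->
  (forall c, (forall x, lincomb u c x = 0) -> forall i, c i = 0) ->
  EqB mu q B n (fun_span u) -> subspace_Lp mu p n (fun_span u).
Proof.
move=> p1 q0 B0 n0 cu uM ind eqB.
have mu_ i : measurable_fun setT (u i : borel T -> R) by exact: continuous_measurable_borel.
exists u; split=> // [i|c c0].
  rewrite inE; apply/andP; split; rewrite inE//=.
  by apply: le_lt_trans (Lnorm_le_sup mu p1 (mu_ i) (uM i)) _; rewrite ltry.
apply: ind => x; apply: contrapT => /eqP fx0.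
have uf : fun_span u (lincomb u c) by exists c.
have mtf t : measurable_fun setT ((fun y => t * lincomb u c y) : borel T -> R).
  by apply: continuous_measurable_borel; apply: fun_span_continuous cu _; exact: fun_spanZ.
have ball t : Lq_ball mu q (fun_span u) (fun y => t * lincomb u c y).
  split; first exact: fun_spanZ.
  rewrite /Lp_norm Lnorm_moment (@ae_eq_integral _ _ _ mu setT (cst 0%E))//.
  - by rewrite integral0 poweR0r ?invr_eq0 ?gt_eqF// lee01.
  - by apply/measurable_EFinP; exact: measurable_normr_powR.
  - case: c0 => N [mN N0 sub]; exists N; split=> //.
    apply: subset_trans sub => y /=; apply: contra_not => -> _.
    by rewrite mulr0 normr0 powR0 ?gt_eqF.
have K0 := EqB_sup_bound q0 B0 n0 eqB (ball _) x.
set K := 4 * B * _ in K0.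
have := K0 ((K + 1) / lincomb u c x).
rewrite divfK//; apply/negP; rewrite -ltNge.
by apply: lt_le_trans (ler_norm _); rewrite ltrDl.
Qed.

End Recovery.

Theorem theorem4p9 (R : realType) (p q : R) (hq : 1 <= q) (hqp : q <= p) :
  exists c C : R, [/\ 0 < c, 0 < C &
    forall (d : nat) (Omega : set 'rV[R]_d) (x0 : Omega),
      compact Omega ->
    forall (mu : probability (borel (pointed_subset x0)) R)
      (F : set {uniform pointed_subset x0 -> R}),
      compact F ->
      (forall f, F f -> continuous (f : pointed_subset x0 -> R)) ->
    forall (B : R), 1 <= B ->
    forall (m n : nat), (0 < m)%N -> (0 < n)%N ->
      c * B `^ p * n%:R `^ (p / q) * ln (2 * B * n%:R) ^+ 2 <= m%:R ->
    forall rec : ('I_m -> pointed_subset x0) -> set (pointed_subset x0 -> R) ->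
        (pointed_subset x0 -> R) -> (pointed_subset x0 -> R),
      lp_recovery p rec ->
      (rho_lp mu p rec F <= C%:E * width_EqB mu q B n F)%E].
Proof.
exists (8 * 16 * 84 * 16 `^ p), (1 + 64 * 4); split.
- by rewrite !mulr_gt0 ?powR_gt0.
- by rewrite ltr_pwDr// mulr_ge0.
move=> d Omega x0 cO mu F _ contF B B1 m n m0 n0 hm rec recP.
have C0 : 0 < 1 + 64 * 4 :> R by rewrite ltr_pwDr// mulr_ge0.
have [C CE] : exists C, C = 1 + 64 * 4 :> R by eexists.
rewrite -CE in C0 *.
have p1 : 1 <= p by exact: le_trans hqp.
have q0 : 0 < q by exact: lt_le_trans ltr01 _.
have B0 : 0 < B by exact: lt_le_trans ltr01 B1.
rewrite -lee_pdivrMl//; apply: le_ereal_inf_tmp => _ [X [[u [cu ind ->]] eqB ->]].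
rewrite lee_pdivrMl//.
have [M uM] : exists M, forall i x, `|u i x| <= M.
  have /choice[M_ uM_] i := continuous_bounded_on_compact cO (cu i).
  exists (\sum_i `|M_ i|) => i x; apply: le_trans (uM_ i x) _.
  by rewrite (bigD1 i)//= (le_trans (ler_norm _))// lerDl sumr_ge0.
have [xi disc] := EqB_discretization hq hqp B1 n0 cu uM ind eqB hm.
apply: ge_ereal_inf; eexists.
  exists xi, n, (fun_span u); split; last reflexivity.
    rewrite n0/= -(ler_nat R); apply: le_trans hm.
    exact: le_sample_size.
  exact: EqB_subspace_Lp eqB.
apply: ge_ereal_sup => _ [f Ff <-].
apply: (@le_trans _ _ (C%:E * ereal_inf [set uniform_norm (f \- g)%R | g in fun_span u])%E); last first.
  rewrite lee_wpmul2l ?lee_fin ?(ltW C0)//; apply: ereal_sup_ubound.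
  by exists f.
rewrite -lee_pdivrMl//; apply: le_ereal_inf_tmp => _ [g ug <-].
rewrite lee_pdivrMl//.
have [recX recmin] := recP xi n u f.
case E : (uniform_norm (f \- g)%R) => [c| |]; last 2 first.
- by rewrite gt0_muley// leey.
- have : (`|f x0 - g x0|%:E <= uniform_norm (f \- g)%R)%E.
    by apply: ereal_sup_ubound; exists x0.
  by rewrite E leeNy_eq.
have fg : forall x, `|f x - g x| <= c by apply/uniform_norm_le; rewrite E.
have k0 : 0 <= 64 :> R by rewrite ler0n.
rewrite -EFinM CE.
exact: (recovery_error_le p1 m0 k0 cu (contF f Ff) disc ug recX fg (recmin g ug)).
Qed.
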